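(* Let $(\Omega,\mu)$ be a measure space with $\mu$ a continuous measure (i.e., without point masses), and let $(u_k)_{k\geq 1}$ be a frame in $L^2_{\mathbb R}(\Omega,\mu)$. Then $$\sum_{k}(u_k^+(x))^2=\sum_k (u_k^-(x))^2=\infty\quad\text{for }\mu\text{-almost every }x\in\Omega.$$ In particular, there exist no positive frames (nor positive Riesz bases) in $L^2_{\mathbb R}(\Omega,\mu)$.
   Context: $L^2_{\mathbb R}(\Omega,\mu)$ is the Lebesgue space of real-valued square-integrable functions. A sequence $(u_k)_{k\ge1}$ in it is a frame if there exist constants $A>0$, $B>0$ with $A\|f\|^2\le\sum_{k\ge1}|(f,u_k)|^2\le B\|f\|^2$ for all $f\in L^2_{\mathbb R}(\Omega,\mu)$. For a real function $u$, $u^{\pm}(x)=\max(0,\pm u(x))$ denote its positive and negative parts.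
   Formalization: ''Continuous'' is taken as non-atomic (each set of positive measure has a subset of smaller positive measure), as μ({x})=0 alone does not suffice; non-existence of positive frames assumes μ(Ω)>0; Riesz bases, being frames, are not stated separately. *)

(* Defs.v *)
From HB Require Import structures.
From mathcomp Require Import all_boot all_order all_algebra.
From mathcomp Require Import all_classical all_reals all_analysis.
Set Implicit Arguments. Unset Strict Implicit. Unset Printing Implicit Defensive.
Import Order.TTheory GRing.Theory Num.Theory.
Local Open Scope classical_set_scope.
Local Open Scope ring_scope.

Definition L2 d (T : measurableType d) (R : realType)
  (mu : {measure set T -> \bar R}) (f : T -> R) : Prop :=
  f \in Lfun mu 2%:E.

Definition L2inner d (T : measurableType d) (R : realType)
  (mu : {measure set T -> \bar R}) (f g : T -> R) : R :=
  Rintegral mu setT (fun x => f x * g x).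

Definition L2norm2 d (T : measurableType d) (R : realType)
  (mu : {measure set T -> \bar R}) (f : T -> R) : R :=
  Rintegral mu setT (fun x => f x ^+ 2).

Definition is_frame d (T : measurableType d) (R : realType)
  (mu : {measure set T -> \bar R}) (u : nat -> T -> R) : Prop :=
  (forall k, L2 mu (u k)) /\
  exists A B : R, 0 < A /\ 0 < B /\
    forall f, L2 mu f ->
      ((A * L2norm2 mu f)%:E <= \sum_(0 <= k <oo) ((L2inner mu f (u k)) ^+ 2)%:E)%E /\
      (\sum_(0 <= k <oo) ((L2inner mu f (u k)) ^+ 2)%:E <= (B * L2norm2 mu f)%:E)%E.

Definition atomless d (T : measurableType d) (R : realType)
  (mu : {measure set T -> \bar R}) : Prop :=
  forall A, measurable A -> (0 < mu A)%E ->
    exists B, [/\ measurable B, B `<=` A, (0 < mu B)%E & (mu B < mu A)%E].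

Definition pospart (R : realType) (T : Type) (u : T -> R) (x : T) : R :=
  Num.max (u x) 0.
Definition negpart (R : realType) (T : Type) (u : T -> R) (x : T) : R :=
  Num.max (- u x) 0.

(* Main.v *)
Require Import Defs.
From HB Require Import structures.
From mathcomp Require Import all_boot all_order all_algebra.
From mathcomp Require Import all_classical all_reals all_analysis.
From mathcomp Require Import measurable_realfun ring lra.
Import Order.TTheory GRing.Theory Num.Theory.
Import numFieldNormedType.Exports.
Local Open Scope classical_set_scope.
Local Open Scope ring_scope.

(* Suppose that [sum_k (u_k^+)^2 <= M] on a set E with [0 < mu E < +oo].  By
   Cauchy-Schwarz the numbers [(1_E, u_k^+)] are square summable, and so are the
   [(1_E, u_k)] by the upper frame bound; hence so are the
   [c_k := (1_E, |u_k|) = 2 (1_E, u_k^+) - (1_E, u_k)].  If [f = +1 or -1] on E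
   and [f = 0] elsewhere, then [|(f, u_k)| <= c_k], so the tail of
   [sum_k (f, u_k)^2] is small uniformly in f, whereas finitely many of the
   [(f, u_k)] can be made as small as desired by letting f oscillate, because mu
   has no atoms.  This contradicts the lower frame bound [A * mu E].  Negative
   parts are handled by the frame [-u_k]. *)

(** * Measures without atoms: small pieces and an induction principle over sets *)

Section atomless_measure.
Set Implicit Arguments.
Unset Strict Implicit.
Context (d : measure_display) (T : measurableType d) (R : realType)
  (mu : {measure set T -> \bar R}).

(** Removing from A a subset B of strictly smaller positive measure leaves two pieces of positive
    measure, and the lighter one has at most half the measure of A. *)
Lemma atomless_halve (A : set T) :
  atomless mu -> measurable A -> (0 < mu A)%E -> (mu A < +oo)%E ->
  exists B, [/\ measurable B, B `<=` A, (0 < mu B)%E & (mu B <= 2^-1%:E * mu A)%E].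
Proof.
move=> muA mA A0 Aoo.
have [B [mB BA B0 BltA]] := muA A mA A0.
have Boo : (mu B < +oo)%E := lt_trans BltA Aoo.
have mAB : measurable (A `\` B) by exact: measurableD.
have DE : mu A = (mu (A `\` B) + mu B)%E.
  by rewrite (measureDI mu mA mB) (setIidr BA).
have Doo : (mu (A `\` B) < +oo)%E.
  by apply: le_lt_trans Aoo; apply: le_measure; rewrite ?inE//; exact: subDsetl.
move: DE BltA B0.
rewrite -(@fineK _ (mu B)) ?ge0_fin_numE// -(@fineK _ (mu (A `\` B))) ?ge0_fin_numE//.
set b := fine (mu B); set c := fine (mu (A `\` B)) => DE.
rewrite DE -EFinD lte_fin => blt; rewrite lte_fin => b0.
have [bc|cb] := leP b c.
  exists B; split => //; rewrite -(@fineK _ (mu B)) ?ge0_fin_numE// -/b ?lte_fin//.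
  rewrite -EFinM lee_fin; lra.
exists (A `\` B); rewrite -(@fineK _ (mu (A `\` B))) ?ge0_fin_numE// -/c.
split; [by []|exact: subDsetl|rewrite lte_fin; lra|].
by rewrite -EFinM lee_fin; lra.
Qed.

(** A may have infinite measure, but the strict inequality in [atomless] yields a subset A' of
    finite positive measure; n halvings bring it down to at most mu A' / 2^n. *)
Lemma atomless_small (A : set T) (e : R) :
  atomless mu -> measurable A -> (0 < mu A)%E -> 0 < e ->
  exists B, [/\ measurable B, B `<=` A, (0 < mu B)%E & (mu B <= e%:E)%E].
Proof.
move=> muA mA A0 e0.
have [A' [mA' A'A A'0 A'lt]] := muA A mA A0.
have A'oo : (mu A' < +oo)%E := lt_le_trans A'lt (leey _).
have [n ne] : exists n, fine (mu A') * 2^-1 ^+ n <= e.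
  have : fine (mu A') * 2^-1 ^+ n @[n --> \oo] --> fine (mu A') * 0.
    by apply: cvgMr; apply: cvg_expr; rewrite gtr0_norm ?invf_lt1 ?invr_gt0// ltr1n.
  rewrite mulr0 => /cvgrPdist_le /(_ e e0)[n _ /(_ n (leqnn n))] /=.
  by rewrite sub0r normrN => ?; exists n; apply: le_trans (ler_norm _) _.
have [B [mB BA B0 Ble]] : exists B, [/\ measurable B, B `<=` A', (0 < mu B)%E &
    (mu B <= (2^-1 ^+ n)%:E * mu A')%E].
  elim: (n) => [|k [B [mB BA B0 Ble]]].
    by exists A'; split => //; rewrite expr0 mul1e.
  have Boo : (mu B < +oo)%E.
    by apply: le_lt_trans A'oo; apply: le_measure; rewrite ?inE.
  have [C [mC CB C0 Cle]] := atomless_halve muA mB B0 Boo.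
  exists C; split => //; first exact: subset_trans BA.
  apply: le_trans Cle _; rewrite exprS EFinM -muleA.
  by rewrite lee_pmul2l// lte_fin invr_gt0.
exists B; split => //; first exact: subset_trans A'A.
apply: le_trans Ble _.
by rewrite -(@fineK _ (mu A')) ?ge0_fin_numE// -EFinM lee_fin mulrC.
Qed.

(* Exhaustion: the measures of the subsets of E in P have a supremum s, reached
   by a countable union U of such sets; E \ U is null, since otherwise a small
   piece of it added to almost optimal sets would exceed s. *)
Lemma atomless_ind (P : set T -> Prop) (e : R) :
  atomless mu -> 0 < e ->
  (forall A, measurable A -> (mu A <= e%:E)%E -> P A) ->
  (forall A B, measurable A -> measurable B -> P A -> P B -> P (A `|` B)) ->
  forall E, measurable E -> (mu E < +oo)%E -> P E.
Proof.
move=> muA e0 Psmall PU E mE Eoo.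
pose S := [set mu F | F in [set F | [/\ measurable F, F `<=` E & P F]]].
have P0 : P set0 by apply: Psmall; rewrite ?measure0// lee_fin ltW.
have S0 : S 0%E by exists set0; [split; [exact: measurable0|exact: sub0set|]|exact: measure0].
have Sub x : S x -> (x <= mu E)%E.
  by move=> [F [mF FE _] <-]; apply: le_measure; rewrite ?inE.
pose s := ereal_sup S.
have sfin : s \is a fin_num.
  rewrite ge0_fin_numE; last exact: ereal_sup_ubound.
  by apply: le_lt_trans Eoo; exact: ge_ereal_sup.
have /choice[F FP] : forall n, exists F, [/\ measurable F, F `<=` E, P F &
    (s - n.+1%:R^-1%:E < mu F)%E].
  move=> n; have n0 : 0 < n.+1%:R^-1 :> R by rewrite invr_gt0.
  by have [_ [F [mF FE PF] <-] sF] := ub_ereal_sup_adherent n0 sfin; exists F.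
have mF n : measurable (F n) by have [] := FP n.
have mU : measurable (\bigcup_n F n) by exact: bigcup_measurable.
have nullD : mu (E `\` \bigcup_n F n) = 0.
  apply/eqP; rewrite eq_le measure_ge0 andbT leNgt; apply/negP => D0.
  have [G [mG GD G0 Ge]] := atomless_small muA (measurableD mE mU) D0 e0.
  have Gfin : mu G \is a fin_num by rewrite ge0_fin_numE// (le_lt_trans Ge) ?ltry.
  have Gle n : (mu G <= n.+1%:R^-1%:E)%E.
    have [_ FE PF sF] := FP n.
    have : (mu (F n `|` G) <= s)%E.
      apply: ereal_sup_ubound; exists (F n `|` G) => //; split.
      - exact: measurableU.
      - by rewrite subUset; split=> // x /GD[].
      - by apply: PU => //; exact: Psmall.
    have -> : mu (F n `|` G) = (mu (F n) + mu G)%E.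
      apply: measureU => //; rewrite -subset0 => x [Fx /GD[_]].
      by apply; exists n.
    have Ffin : mu (F n) \is a fin_num.
      by rewrite ge0_fin_numE//; apply: le_lt_trans Eoo; apply: le_measure; rewrite ?inE.
    move: sF; rewrite -(fineK sfin) -(fineK Gfin) -(fineK Ffin).
    rewrite -EFinB -EFinD lte_fin !lee_fin.
    by move: (fine _) (fine _) (fine _) (_^-1) => a b c i; lra.
  move: G0; rewrite -(fineK Gfin) lte_fin => G0.
  have /cvgrPdist_lt/(_ _ G0)[n _ /(_ n (leqnn n))] := @cvg_harmonic R.
  rewrite sub0r normrN /harmonic/= ger0_norm ?invr_ge0//.
  by have := Gle n; rewrite -{1}(fineK Gfin) lee_fin => /le_lt_trans h /h; rewrite ltxx.
(* P passes to finite unions only, hence the partial unions U n. The remainders of E decrease to a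
   null set and mu E is finite, so some remainder has measure at most e and is settled by
   [Psmall]. *)
pose U n := \big[setU/set0]_(i < n) F i.
have mUn n : measurable (U n) by exact: bigsetU_measurable.
have PUn n : P (U n).
  rewrite /U; elim: n => [|n ih]; first by rewrite big_ord0.
  by rewrite big_ord_recr/=; apply: PU => //; [exact: mUn|have [] := FP n].
have UE n : U n `<=` E.
  by rewrite /U -bigcup_mkord => x [i _]; have [_ + _ _] := FP i; apply.
have : (mu \o (fun n => E `\` U n)) n @[n --> \oo] --> mu (\bigcap_n (E `\` U n)).
  apply: nonincreasing_cvg_mu => //.
  - by apply: le_lt_trans Eoo; apply: le_measure; rewrite ?inE//;
      exact: measurableD.
  - by move=> i; exact: measurableD.
  - by apply: bigcap_measurable => // i _; exact: measurableD.
  - move=> m n mn; apply/subsetPset; apply: setDS.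
    rewrite /U -!bigcup_mkord => x [i /= im Fi].
    by exists i => //=; exact: leq_trans mn.
have -> : \bigcap_n (E `\` U n) = E `\` \bigcup_n F n.
  apply/seteqP; split => x.
    move=> EUx; split; first by have [] := EUx 0%N I.
    move=> [i _ Fi]; have [_] := EUx i.+1 I; apply.
    by rewrite /U -bigcup_mkord; exists i => //=.
  move=> [Ex nFx] n _; split=> //; rewrite /U -bigcup_mkord => -[i _ Fi].
  by apply: nFx; exists i.
rewrite nullD => /(_ [set x | (x < e%:E)%E])[].
  by apply: open_ereal_lt'; rewrite lte_fin.
move=> n _ /(_ n (leqnn n)) /= /ltW Dn.
rewrite -(setDUK (UE n)); apply: PU => //; first exact: measurableD.
by apply: Psmall => //; exact: measurableD.
Qed.

End atomless_measure.

(** * Square integrable functions: inner product and Cauchy-Schwarz *)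

Section square_integrable.
Set Implicit Arguments.
Unset Strict Implicit.
Context (d : measure_display) (T : measurableType d) (R : realType)
  (mu : {measure set T -> \bar R}).
Implicit Types (f g u : T -> R) (A E : set T).

(** Trades the norm with real powers behind [Lfun] for integrability of the square, the form suited
    to domination and to indicators. *)
Lemma L2P f : L2 mu f <->
  measurable_fun setT f /\ mu.-integrable setT (EFin \o (fun x => f x ^+ 2)).
Proof.
split=> [L2f|[mf /integrableP[_ foo]]].
  split; last exact: Lfun2_integrable_sqr.
  by have := sub_Lfun_mfun L2f; rewrite inE.
rewrite /L2 inE; apply/andP; split; rewrite inE//=.
rewrite /finite_norm unlock /=; apply: poweR_lty.
apply: le_lt_trans foo; apply: ge0_le_integral => //=.
- apply/measurable_EFinP.
  apply: (@measurableT_comp _ _ _ _ _ _ (fun x : R => x `^ 2)) => //.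
  exact: measurableT_comp.
- by do 2 apply: measurableT_comp => //; exact: measurable_funX.
- by move=> x _; rewrite lee_fin normrX powR_mulrn.
Qed.

Lemma L2_measurable f : L2 mu f -> measurable_fun setT f.
Proof. by move=> /L2P[]. Qed.

Lemma L2_le f g : measurable_fun setT f -> (forall x, `|f x| <= `|g x|) ->
  L2 mu g -> L2 mu f.
Proof.
move=> mf fg /L2P[mg ig]; apply/L2P; split => //.
apply: le_integrable ig => //.
  by apply/measurable_EFinP; exact: measurable_funX.
by move=> x _; rewrite /= lee_fin !normrX lerXn2r// nnegrE.
Qed.

Lemma L2_comb (a b : R) f g : L2 mu f -> L2 mu g ->
  L2 mu (fun x => a * f x + b * g x).
Proof.
move=> fL gL.
have aL (c : R) h : L2 mu h -> L2 mu (fun x => c * h x).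
  move=> hL; rewrite (_ : (fun x => _) = c \o* h).
    by apply: Lfun_scale => //; rewrite ler1n.
  by apply/funext => x /=; rewrite mulrC.
exact: (Lfun_addr_closed _ (lee1n 2)).2 (aL a f fL) (aL b g gL).
Qed.

Lemma L2_mul_integrable f g : L2 mu f -> L2 mu g ->
  mu.-integrable setT (EFin \o (fun x => f x * g x)).
Proof. by move=> fL gL; apply/Lfun1_integrable; exact: Lfun2_mul_Lfun1. Qed.

Lemma L2inner_combl (a b : R) f g u : L2 mu f -> L2 mu g -> L2 mu u ->
  L2inner mu (fun x => a * f x + b * g x) u =
  a * L2inner mu f u + b * L2inner mu g u.
Proof.
move=> fL gL uL; have fu := L2_mul_integrable fL uL; have gu := L2_mul_integrable gL uL.
rewrite /L2inner -RintegralZl// -RintegralZl// -RintegralD//.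
- by congr Rintegral; apply/funext => x; ring.
- exact: (integrableZl measurableT a fu).
- exact: (integrableZl measurableT b gu).
Qed.

Lemma L2innerC f g : L2inner mu f g = L2inner mu g f.
Proof. by congr Rintegral; apply/funext => x; rewrite mulrC. Qed.

Lemma L2norm2E f : L2norm2 mu f = L2inner mu f f.
Proof. by []. Qed.

Lemma L2norm2_ge0 f : 0 <= L2norm2 mu f.
Proof. by apply: Rintegral_ge0 => x _; exact: sqr_ge0. Qed.

Lemma L2norm2_comb (a b : R) f g : L2 mu f -> L2 mu g ->
  L2norm2 mu (fun x => a * f x + b * g x) =
  a ^+ 2 * L2norm2 mu f + 2 * a * b * L2inner mu f g + b ^+ 2 * L2norm2 mu g.
Proof.
move=> fL gL; have hL := L2_comb a b fL gL.
rewrite !L2norm2E (L2inner_combl a b fL gL hL) (L2innerC f) (L2innerC g).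
by rewrite (L2inner_combl a b fL gL fL) (L2inner_combl a b fL gL gL) (L2innerC g f); ring.
Qed.

(** The squared norm of a f + b g is a nonnegative quadratic form in (a, b); evaluating it at one
    suitable point is enough. *)
Lemma cauchy_schwarz f g : L2 mu f -> L2 mu g ->
  L2inner mu f g ^+ 2 <= L2norm2 mu f * L2norm2 mu g.
Proof.
move=> fL gL.
have H (a b : R) : 0 <= a ^+ 2 * L2norm2 mu f + 2 * a * b * L2inner mu f g
    + b ^+ 2 * L2norm2 mu g by rewrite -L2norm2_comb// L2norm2_ge0.
move: (L2norm2_ge0 f) (L2norm2_ge0 g) H.
move: (L2norm2 mu f) (L2inner mu f g) (L2norm2 mu g) => x z y x0 y0 H.
have [yp|] := ltrP 0 y.
  (* At this point the form equals y * (x * y - z ^+ 2). *)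
  by have := H y (- z); nra.
move=> yle; have y00 : y = 0 by lra.
(* With y = 0 the form equals - (x + 2) * z ^+ 2 here, which forces z = 0. *)
have := H z (- (x + 1)); rewrite y00; nra.
Qed.

Lemma L2_indic E : measurable E -> (mu E < +oo)%E -> L2 mu \1_E.
Proof.
move=> mE Eoo; apply/L2P; split; first exact: measurable_indic.
apply/integrableP; split.
  by apply/measurable_EFinP; apply: measurable_funX; exact: measurable_indic.
rewrite (_ : (fun _ => _) = EFin \o \1_E).
  by rewrite integral_indic// setIT.
apply/funext => x /=; rewrite indicE.
by case: (x \in E); rewrite ?expr1n ?expr0n/= ?normr1 ?normr0.
Qed.

(** Only the square of f is prescribed, so that the lemma serves both the indicator of E and
    functions with values +1 and -1 on E. *)
Lemma L2norm2_indic E f : measurable E -> (forall x, f x ^+ 2 = \1_E x) ->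
  L2norm2 mu f = fine (mu E).
Proof.
move=> mE fE; rewrite /L2norm2 /Rintegral.
by under eq_integral do rewrite fE; rewrite integral_indic// setIT.
Qed.

Lemma L2_indic_mul E f : measurable E -> L2 mu f -> L2 mu (fun x => \1_E x * f x).
Proof.
move=> mE fL; apply: (L2_le _ _ fL).
  by apply: measurable_funM => //; exact: L2_measurable fL.
by move=> x; rewrite indicE; case: (x \in E); rewrite ?mul1r ?mul0r ?normr0.
Qed.

End square_integrable.

(** * Indicators of disjoint sets *)

Section indicators.
Context {T : Type} {R : realType} {A B : set T}.
Hypothesis AB : A `&` B = set0.

Lemma indicM_disjoint (x : T) : \1_A x * \1_B x = 0 :> R.
Proof.
by have /(congr1 (fun h => h x)) := @indicI T R A B; rewrite AB indic0 /= => <-.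
Qed.

Lemma indicU_disjoint (x : T) : \1_(A `|` B) x = \1_A x + \1_B x :> R.
Proof.
have := indicM_disjoint x; rewrite !indicE in_setU.
by case: (x \in A); case: (x \in B); rewrite ?(addr0, add0r, mulr1)//= => /eqP; rewrite oner_eq0.
Qed.

End indicators.

(** * Oscillating functions almost orthogonal to finitely many [u k] *)

Section sign_balancing.
Set Implicit Arguments.
Unset Strict Implicit.
Context (d : measure_display) (T : measurableType d) (R : realType)
  (mu : {measure set T -> \bar R}).
Variables (u : nat -> T -> R) (N : nat).
Hypothesis muA : atomless mu.
Hypothesis uL : forall k, L2 mu (u k).

Let energy (E : set T) := \sum_(k < N) L2norm2 mu (fun x => \1_E x * u k x).
Let defect (f : T -> R) := \sum_(k < N) L2inner mu f (u k) ^+ 2.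

(** Disjoint supports kill the cross term. Additivity lets the bounds on two disjoint pieces add up
    to a bound of the same shape. *)
Let energyU (A B : set T) : measurable A -> measurable B -> A `&` B = set0 ->
  energy (A `|` B) = energy A + energy B.
Proof.
move=> mA mB AB; rewrite /energy -big_split/=; apply: eq_bigr => k _.
have AL := L2_indic_mul mA (uL k); have BL := L2_indic_mul mB (uL k).
have I0 : L2inner mu (fun x => \1_A x * u k x) (fun x => \1_B x * u k x) = 0.
  rewrite /L2inner (_ : (fun x => _) = cst 0) ?Rintegral_cst ?mul0r//.
  apply/funext => x /=; rewrite mulrACA.
  by rewrite (indicM_disjoint AB) mul0r.
have := L2norm2_comb 1 1 AL BL; rewrite I0 mulr0 addr0 expr1n !mul1r => <-.
congr L2norm2; apply/funext => x; rewrite !mul1r -mulrDl; congr (_ * _).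
by rewrite (indicU_disjoint AB).
Qed.

Let defect_comb (f g : T -> R) : L2 mu f -> L2 mu g ->
  exists s : bool, defect (fun x => 1 * f x + (-1) ^+ s * g x) <= defect f + defect g.
Proof.
move=> fL gL.
pose c := \sum_(k < N) L2inner mu f (u k) * L2inner mu g (u k).
have E s : defect (fun x => 1 * f x + (-1) ^+ s * g x) =
    defect f + 2 * (-1) ^+ s * c + defect g.
  rewrite /defect /c mulr_sumr -!big_split/=; apply: eq_bigr => k _.
  rewrite L2inner_combl//.
  have : (-1) ^+ s * (-1) ^+ s = 1 :> R by rewrite -expr2 sqrr_sign.
  move: ((-1) ^+ s) => e ee.
  move: (L2inner _ f _) (L2inner _ g _) => p q.
  rewrite mul1r (_ : (p + e * q) ^+ 2 = p ^+ 2 + 2 * e * (p * q) + e * e * q ^+ 2).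
    by rewrite ee mul1r.
  ring.
(* The sign is -1 exactly when c >= 0, so the cross term is -2|c|. *)
exists (0 <= c); rewrite E; case: (leP 0 c) => /= c0; rewrite ?expr1 ?expr0; lra.
Qed.

(* Greedy choice of signs: Cauchy-Schwarz settles a set of measure at most [e]
   with [f] its indicator, and when two disjoint sets are put together one of
   the two relative signs makes the cross term nonpositive. *)
Lemma sign_balancing (e : R) (E : set T) : 0 < e -> measurable E -> (mu E < +oo)%E ->
  exists f : T -> R, [/\ L2 mu f, forall x, f x ^+ 2 = \1_E x &
    \sum_(k < N) L2inner mu f (u k) ^+ 2 <=
    e * \sum_(k < N) L2norm2 mu (fun x => \1_E x * u k x)].
Proof.
move=> e0 mE Eoo.
(* All measurable subsets of A are included because [atomless_ind] joins sets that may overlap: H is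
   then cut into its part in A and its part outside A, and the latter lies in B. *)
pose P (A : set T) := forall H, measurable H -> H `<=` A ->
  exists f : T -> R, [/\ L2 mu f, forall x, f x ^+ 2 = \1_H x &
    defect f <= e * energy H].
suff : P E by apply.
apply: (atomless_ind muA e0) => // [A mA Ae H mH HA|A B mA mB PA PB H mH HAB].
- have He : (mu H <= e%:E)%E by apply: le_trans Ae; apply: le_measure; rewrite ?inE.
  have HL : L2 mu \1_H by apply: L2_indic => //; rewrite (le_lt_trans He) ?ltry.
  have HH x : \1_H x ^+ 2 = \1_H x :> R.
    by rewrite indicE; case: (x \in H); rewrite ?expr1n ?expr0n.
  exists \1_H; split => //.
  rewrite /defect /energy mulr_sumr; apply: ler_sum => k _.
  have kL := L2_indic_mul mH (uL k).
  (* Restricting u_k to H first makes Cauchy-Schwarz produce the energy on H alone, with the factor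
     mu H <= e. *)
  have -> : L2inner mu \1_H (u k) = L2inner mu \1_H (fun x => \1_H x * u k x).
    by congr Rintegral; apply/funext => x; rewrite mulrA -expr2 HH.
  apply: le_trans (cauchy_schwarz HL kL) _.
  rewrite ler_wpM2r ?L2norm2_ge0// (L2norm2_indic mu mH HH).
  by rewrite -lee_fin fineK// ge0_fin_numE// (le_lt_trans He) ?ltry.
- have mHA : measurable (H `&` A) by exact: measurableI.
  have mHB : measurable (H `\` A) by exact: measurableD.
  have [f [fL f1 fe]] := PA _ mHA (@subIsetr _ _ _).
  have [g [gL g1 ge]] : exists g : T -> R, [/\ L2 mu g,
      forall x, g x ^+ 2 = \1_(H `\` A) x & defect g <= e * energy (H `\` A)].
    by apply: PB => // x [/HAB[]].
  have [s sle] := defect_comb fL gL.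
  have D0 : (H `&` A) `&` (H `\` A) = set0.
    by rewrite -subset0 => x [[_ Ax] [_]]; apply.
  have HE : H = (H `&` A) `|` (H `\` A) by rewrite setUIDK.
  exists (fun x => 1 * f x + (-1) ^+ s * g x); split.
  + exact: L2_comb.
  + move=> x.
    have fg : f x * g x = 0.
      apply/eqP; rewrite -sqrf_eq0 exprMn f1 g1.
      by rewrite (indicM_disjoint D0).
    rewrite mul1r sqrrD exprMn sqrr_sign mul1r mulrCA fg mulr0 mul0rn addr0.
    by rewrite f1 g1 [in RHS]HE (indicU_disjoint D0).
  + apply: le_trans sle _; rewrite [in X in _ <= X]HE energyU// mulrDr.
    exact: lerD.
Qed.

End sign_balancing.

(** * Frames and the divergence of the series of positive parts *)

Section frames.
Set Implicit Arguments.
Unset Strict Implicit.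
Context (d : measure_display) (T : measurableType d) (R : realType)
  (mu : {measure set T -> \bar R}).
Implicit Types (u : nat -> T -> R) (E : set T).

Lemma pospart_ge0 (f : T -> R) x : 0 <= pospart f x.
Proof. by rewrite /pospart le_max lexx orbT. Qed.

(** The shape matches [L2inner_combl], which then expresses (1_E, |u_k|) through (1_E, u_k^+) and
    (1_E, u_k). *)
Lemma normr_pospart (f : T -> R) x : `|f x| = 2 * pospart f x + (-1) * f x.
Proof.
by rewrite /pospart; case: (leP (f x) 0) => fx; [rewrite ler0_norm|rewrite gtr0_norm]; lra.
Qed.

Lemma measurable_pospart (f : T -> R) : measurable_fun setT f ->
  measurable_fun setT (pospart f).
Proof. by move=> mf; apply: measurable_maxr. Qed.

Lemma L2_pospart (f : T -> R) : L2 mu f -> L2 mu (pospart f).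
Proof.
move=> fL; apply: (L2_le _ _ fL).
  exact/measurable_pospart/(L2_measurable fL).
move=> x; rewrite ger0_norm ?pospart_ge0//.
by rewrite /pospart ge_max normr_ge0 ler_norm.
Qed.

Lemma L2norm2_EFin (f : T -> R) : L2 mu f ->
  (L2norm2 mu f)%:E = (\int[mu]_x (f x ^+ 2)%:E)%E.
Proof.
by move=> /L2P[_ fi]; rewrite /L2norm2 /Rintegral fineK//; exact: integrable_fin_num.
Qed.

(** Cauchy-Schwarz bounds the k-th term by mu E times the integral of (u_k^+)^2 over E; after
    exchanging sum and integral, the total is at most M * (mu E)^2. *)
Lemma pospart_summable u (E : set T) (M : R) :
  (forall k, L2 mu (u k)) -> measurable E -> (mu E < +oo)%E ->
  (forall x, E x -> (\sum_(0 <= k <oo) (pospart (u k) x ^+ 2)%:E <= M%:E)%E) ->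
  (\sum_(0 <= k <oo) ((L2inner mu \1_E (pospart (u k))) ^+ 2)%:E < +oo)%E.
Proof.
move=> uL mE Eoo EM.
have pL k := L2_pospart (uL k).
have EpL k := L2_indic_mul mE (pL k).
have EE x : \1_E x ^+ 2 = \1_E x :> R.
  by rewrite indicE; case: (x \in E); rewrite ?expr1n ?expr0n.
set m := fine (mu E).
have m0 : 0 <= m by exact: fine_ge0.
apply: (@le_lt_trans _ _ (m%:E * \sum_(0 <= k <oo)
    (L2norm2 mu (fun x => (\1_E x * pospart (u k) x)%R))%:E)%E).
  rewrite -nneseriesZl; last by move=> k _; rewrite lee_fin L2norm2_ge0.
  apply: lee_nneseries => [k _ _|k _]; first by rewrite lee_fin sqr_ge0.
  rewrite -EFinM lee_fin.
  have -> : L2inner mu \1_E (pospart (u k)) =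
      L2inner mu \1_E (fun x => \1_E x * pospart (u k) x).
    by congr Rintegral; apply/funext => x; rewrite mulrA -expr2 EE.
  apply: le_trans (cauchy_schwarz (L2_indic mE Eoo) (EpL k)) _.
  by rewrite (L2norm2_indic mu mE EE).
have -> : (\sum_(0 <= k <oo) (L2norm2 mu (fun x => (\1_E x * pospart (u k) x)%R))%:E)%E
    = (\int[mu]_x \sum_(0 <= k <oo) ((\1_E x * pospart (u k) x) ^+ 2)%:E)%E.
  rewrite integral_nneseries//.
  - by apply: eq_eseriesr => k _; rewrite L2norm2_EFin.
  - move=> k; apply/measurable_EFinP; apply: measurable_funX.
    exact: L2_measurable (EpL k).
  - by move=> k x _; rewrite lee_fin sqr_ge0.
apply: (@le_lt_trans _ _ (m%:E * (M%:E * mu E))%E).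
  rewrite lee_wpmul2l ?lee_fin//.
  rewrite [leLHS](_ : _ =
      (\int[mu]_(x in E) \sum_(0 <= k <oo) (pospart (u k) x ^+ 2)%:E)%E).
    rewrite -integral_cst//; apply: ge0_le_integral => //.
    - by move=> x _; apply: nneseries_ge0 => k _ _; rewrite lee_fin sqr_ge0.
    - apply: (@ge0_emeasurable_sum _ _ _ _ _ predT) => [k x _ _|k _].
        by rewrite lee_fin sqr_ge0.
      apply/measurable_EFinP/measurable_funX/measurable_funTS.
      exact: L2_measurable (pL k).
  rewrite [RHS]integral_mkcond; apply: eq_integral => x _; rewrite patchE indicE.
  case: (x \in E); first by apply: eq_eseriesr => k _; rewrite mul1r.
  by apply: eseries0 => k _ _; rewrite mul0r expr0n.
by rewrite -(@fineK _ (mu E)) ?ge0_fin_numE// -!EFinM ltry.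
Qed.

Lemma frame_pospart_unbounded u (E : set T) (M : R) :
  atomless mu -> is_frame mu u -> measurable E -> (0 < mu E)%E -> (mu E < +oo)%E ->
  ~ (forall x, E x -> (\sum_(0 <= k <oo) (pospart (u k) x ^+ 2)%:E <= M%:E)%E).
Proof.
move=> muA [uL [A [B [A0 [B0 frame]]]]] mE E0 Eoo EM.
set m := fine (mu E).
have m0 : 0 < m by apply: fine_gt0; rewrite E0.
have EL := L2_indic mE Eoo.
have psum := pospart_summable uL mE Eoo EM.
pose c k := L2inner mu \1_E (fun x => `|u k x|).
have cE k : c k = 2 * L2inner mu \1_E (pospart (u k)) + (-1) * L2inner mu \1_E (u k).
  rewrite ![L2inner _ \1_E _]L2innerC -L2inner_combl//; last exact: L2_pospart.
  by rewrite /c L2innerC; congr Rintegral; apply/funext => x; rewrite normr_pospart.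
have csum : (\sum_(0 <= k <oo) (c k ^+ 2)%:E < +oo)%E.
  (* The constants come from (2q - p)^2 + (2q + p)^2 = 8q^2 + 2p^2, with q = (1_E, u_k^+) and p =
     (1_E, u_k). *)
  apply: (@le_lt_trans _ _ (\sum_(0 <= k <oo)
    (8%:E * (L2inner mu \1_E (pospart (u k)) ^+ 2)%:E +
     2%:E * (L2inner mu \1_E (u k) ^+ 2)%:E))%E).
    apply: lee_nneseries => [k _ _|k _]; first by rewrite lee_fin sqr_ge0.
    rewrite -!EFinM -EFinD lee_fin cE.
    move: (L2inner _ _ _) (L2inner _ _ _) => p q.
    by have := sqr_ge0 (2 * q + p); nra.
  rewrite nneseriesD; last 2 first.
  - by move=> k _ _; rewrite mule_ge0// lee_fin ?sqr_ge0.
  - by move=> k _ _; rewrite mule_ge0// lee_fin ?sqr_ge0.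
  rewrite !nneseriesZl; last 2 first.
  - by move=> k _; rewrite lee_fin sqr_ge0.
  - by move=> k _; rewrite lee_fin sqr_ge0.
  rewrite lte_add_pinfty// lte_mul_pinfty ?lee_fin//.
  by apply: le_lt_trans (frame _ EL).2 _; rewrite ltry.
(* Head and tail of the sum of the (f, u_k)^2 will each be at most this number, hence together at
   most half of the lower frame bound A * m. The index N depends on c only, so it is fixed before
   f. *)
have Am : 0 < A * m / 4 by rewrite divr_gt0// mulr_gt0.
have [N tailN] : exists N, (\sum_(N <= k <oo) (c k ^+ 2)%:E < (A * m / 4)%:E)%E.
  have c0 k : predT k -> (0 <= (c k ^+ 2)%:E)%E by rewrite lee_fin sqr_ge0.
  have [] := nneseries_tail_cvg csum c0 (t := [set x | (x < (A * m / 4)%:E)%E]).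
    by apply: open_ereal_lt'; rewrite lte_fin.
  move=> n _ /(_ n (leqnn n)) /= ?; by exists n.
pose K := \sum_(k < N) L2norm2 mu (fun x => \1_E x * u k x).
have K0 : 0 <= K by apply: sumr_ge0 => k _; exact: L2norm2_ge0.
(* K may vanish; the denominator K + 1 is positive and still gives e * K <= A * m / 4. *)
have e0 : 0 < (A * m / 4) / (K + 1) by rewrite divr_gt0// ltr_wpDl.
have [f [fL f1 fe]] := @sign_balancing _ _ _ mu u N muA uL _ _ e0 mE Eoo.
have {}fe : \sum_(k < N) L2inner mu f (u k) ^+ 2 <= A * m / 4.
  apply: le_trans fe _; rewrite -/K mulrAC ler_pdivrMr ?ltr_wpDl//.
  by rewrite ler_wpM2l ?(ltW Am)// lerDl.
have fabs x : `|f x| = \1_E x.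
  have E01 : 0 <= \1_E x :> R by rewrite indicE.
  by rewrite -sqrtr_sqr f1 -[RHS]ger0_norm// -sqrtr_sqr indicE; case: (x \in E);
    rewrite ?expr1n ?expr0n.
have fc k : L2inner mu f (u k) ^+ 2 <= c k ^+ 2.
  rewrite -[leLHS]real_normK ?num_real// lerXn2r ?nnegrE//.
    by apply: Rintegral_ge0 => x _; rewrite mulr_ge0// indicE.
  apply: le_trans (le_normr_Rintegral measurableT (L2_mul_integrable fL (uL k))) _.
  rewrite le_eqVlt; apply/orP; left; apply/eqP.
  by congr Rintegral; apply/funext => x; rewrite normrM fabs.
have [+ _] := frame _ fL; rewrite (L2norm2_indic mu mE f1) -/m.
rewrite (nneseries_split 0 N); last by move=> k _; rewrite lee_fin sqr_ge0.
rewrite add0n big_mkord sumEFin => le1.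
have le2 : (\sum_(N <= k <oo) (L2inner mu f (u k) ^+ 2)%:E <= (A * m / 4)%:E)%E.
  apply: le_trans (ltW tailN); apply: lee_nneseries => [k _ _|k _].
    by rewrite lee_fin sqr_ge0.
  by rewrite lee_fin.
have := le_trans le1 (leeD2l _ le2).
rewrite -EFinD lee_fin => le3.
have Am' : 0 < A * m by rewrite mulr_gt0.
lra.
Qed.

(** The series is finite on the countable union of its sublevel sets at integer heights, so it
    suffices that each of these is null. *)
Lemma frame_pospart_series u : atomless mu -> is_frame mu u ->
  {ae mu, forall x, (\sum_(0 <= k <oo) ((pospart (u k) x) ^+ 2)%:E = +oo)%E}.
Proof.
move=> muA uF; pose g x := (\sum_(0 <= k <oo) ((pospart (u k) x) ^+ 2)%:E)%E.
have mg : measurable_fun setT g.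
  apply: (@ge0_emeasurable_sum _ _ _ _ _ predT) => [k x _ _|k _].
    by rewrite lee_fin sqr_ge0.
  apply/measurable_EFinP; apply: measurable_funX.
  exact/measurable_pospart/(L2_measurable (uF.1 k)).
have g0 x : (0 <= g x)%E.
  by apply: nneseries_ge0 => k _ _; rewrite lee_fin sqr_ge0.
have mgM (M : nat) : measurable [set x | (g x <= M%:R%:E)%E].
  by rewrite -[X in measurable X]setTI; exact: emeasurable_fun_infty_c.
apply: (@negligibleS _ _ _ _ (\bigcup_M [set x | (g x <= M%:R%:E)%E])).
  move=> x /= gx; have gfin : g x \is a fin_num.
    by rewrite ge0_fin_numE// lt_neqAle leey andbT; apply/eqP.
  exists (Num.truncn (fine (g x))).+1 => //=.
  rewrite -(fineK gfin) lee_fin; apply/ltW/truncnS_gt.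
apply: negligible_bigcup => M; apply/negligibleP; first exact: mgM.
apply/eqP; rewrite eq_le measure_ge0 andbT leNgt; apply/negP => gM0.
(* The strict inequality in [atomless] makes mu E finite even when the sublevel set has infinite
   measure. *)
have [E [mE EM E0 Elt]] := muA _ (mgM M) gM0.
apply: (frame_pospart_unbounded muA uF mE E0 (lt_le_trans Elt (leey _))) => x.
exact: EM.
Qed.

(** Reduces negative parts to positive ones: [negpart] of u_k is by definition [pospart] of -u_k,
    and squared coefficients do not see the sign. *)
Lemma is_frameN u : is_frame mu u -> is_frame mu (fun k x => - u k x).
Proof.
move=> [uL [A [B [A0 [B0 frame]]]]]; split.
  move=> k; have := L2_comb (-1) 0 (uL k) (uL k).
  by congr (L2 mu _); apply/funext => x; rewrite mul0r addr0 mulN1r.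
exists A, B; split=> //; split=> // f fL.
have E k : L2inner mu f (fun x => - u k x) = - L2inner mu f (u k).
  have := L2inner_combl (-1) 0 (uL k) (uL k) fL.
  rewrite mul0r addr0 mulN1r (L2innerC mu f (u k)) => <-.
  by congr Rintegral; apply/funext => x; ring.
by under eq_eseriesr do rewrite E sqrrN; exact: frame.
Qed.

End frames.

Theorem theorem1p1 (d : measure_display) (T : measurableType d) (R : realType)
  (mu : {measure set T -> \bar R}) (u : nat -> T -> R) :
  atomless mu -> is_frame mu u ->
  {ae mu, forall x,
     (\sum_(0 <= k <oo) ((pospart (u k) x) ^+ 2)%:E = +oo)%E /\
     (\sum_(0 <= k <oo) ((negpart (u k) x) ^+ 2)%:E = +oo)%E} /\
  ((0 < mu setT)%E ->
     ~ exists v : nat -> T -> R,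
         is_frame mu v /\ forall k, {ae mu, forall x, 0 <= v k x}).
Proof.
move=> muA uF.
have neg (w : nat -> T -> R) : is_frame mu w ->
    {ae mu, forall x, (\sum_(0 <= k <oo) ((negpart (w k) x) ^+ 2)%:E = +oo)%E}.
  by move=> /is_frameN; exact: frame_pospart_series.
split.
  by apply: filterS2 (frame_pospart_series muA uF) (neg _ uF) => x.
move=> T0 [v [vF v0]].
(* For such a v the series of negative parts would be both 0 and +oo almost everywhere, so the whole
   space would be null. *)
have /negligibleP : mu.-negligible [set: T].
  have : {ae mu, forall x, False}.
    apply: filterS2 (ae_foralln v0) (neg _ vF) => x v0x.
    rewrite eseries0// => k _ _.
    by rewrite /negpart max_r ?oppr_le0// expr0n.
  by apply: negligibleS => x _ [].
by move=> /(_ measurableT) TE; rewrite TE ltxx in T0.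
Qed.
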